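(* A finite group $G$ has exactly $|G|-3$ cyclic subgroups if and only if $G$ is isomorphic to one of the following groups: $Q_8$, $C_5$, or $D_{10}$.
   Context: $C_n$ denotes the cyclic group of order $n$, $D_{2n}$ denotes the dihedral group of order $2n$, and $Q_8$ is the quaternion group of order $8$. The trivial subgroup counts as a cyclic subgroup. *)

(* Defs.v *)
From mathcomp Require Import all_boot all_fingroup.
From mathcomp Require Import zmodp cyclic extremal.

Set Implicit Arguments.
Unset Strict Implicit.
Unset Printing Implicit Defensive.

(* Main.v *)
Require Import Defs.
From mathcomp Require Import all_boot all_fingroup.
From mathcomp Require Import zmodp cyclic extremal.
From mathcomp Require Import pgroup sylow.

Set Implicit Arguments.
Unset Strict Implicit.
Unset Printing Implicit Defensive.

(* Sorting the elements of G by the cyclic subgroup they generate gives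
   |G| - c(G) = \sum_H (phi(|H|) - 1), summed over the cyclic subgroups H; only
   those of order > 2 contribute.  If the sum is 3, either a single H
   contributes, with phi(|H|) = 4, and then |H| = 5; or exactly three contribute,
   all of order 3, 4 or 6, so that G has exactly 6 elements of order > 2.

   In the first case every element outside H is an involution inverting H, so
   G is C_5 or D_10.  In the second case an element c of order 3 would normalize,
   hence centralize, the three subgroups; multiplying the solutions of x^2 = 1 in
   C_G(c) by c and c^-1 gives too many elements of order > 2.  So G is a 2-group,
   and one of the three subgroups, <a> of order 4, is normal since 3 is odd.  The
   same counting shows that a is not centralized by some x of order 4; then a and
   x generate a quaternion group, and an element y outside of it would invert it,
   although it is not abelian. *)

Local Open Scope group_scope.

(** A prime power p^k exactly dividing [n] has totient at most that of [n], so it is one of 2, 4, 8,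
    3, 5. Hence [n] divides 120, and its divisors are checked by computation. *)
Lemma totient_le4 n : 0 < n -> totient n <= 4 ->
  n \in [:: 1; 2; 3; 4; 5; 6; 8; 10; 12]%N.
Proof.
move=> n_gt0 tn_le4.
have n120: n %| 120.
  apply/dvdn_partP=> // p; rewrite mem_primes => /and3P[p_pr _ p_n].
  rewrite p_part; set k := logn p n.
  have k_gt0: 0 < k by rewrite logn_gt0 mem_primes p_pr n_gt0.
  have: totient (p ^ k) <= 4.
    apply: leq_trans tn_le4.
    have [m cpm ->] := pfactor_coprime p_pr n_gt0.
    rewrite totient_coprime ?coprimeXr 1?coprime_sym // leq_pmull // totient_gt0.
    by case: m cpm => //; rewrite /coprime gcdn0; case: p p_pr {p_n k k_gt0} => [|[]].
  rewrite totient_pfactor // -(prednK k_gt0) /=.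
  move: k.-1 => j {k k_gt0 n_gt0 tn_le4 p_n}.
  have p_gt1 := prime_gt1 p_pr.
  have lep: p.-1 <= p.-1 * p ^ j by rewrite leq_pmulr // expn_gt0 ltnW.
  move=> le4; move/leq_trans/(_ le4): lep.
  case: p p_pr p_gt1 le4 => [|[|[|[|[|[|p]]]]]] //= _ _ le4 _.
  - case: j le4 => [|[|[|j]]] //; rewrite !expnS mul1n !mulnA leqNgt.
    by rewrite (@leq_trans (2 * 2 * 2)) // leq_pmulr // expn_gt0.
  - case: j le4 => [|j] //; rewrite !expnS !mulnA leqNgt.
    by rewrite (@leq_trans (2 * 3)) // leq_pmulr // expn_gt0.
  - case: j le4 => [|j] //; rewrite !expnS !mulnA leqNgt.
    by rewrite (@leq_trans (4 * 5)) // leq_pmulr // expn_gt0.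
have: n \in divisors 120 by rewrite -dvdn_divisors.
have: all (fun m => (totient m <= 4) ==>
    (m \in [:: 1; 2; 3; 4; 5; 6; 8; 10; 12]%N)) (divisors 120) by vm_compute.
by move/allP=> H /H; rewrite tn_le4.
Qed.

(** * Counting cyclic subgroups by their generators *)

Section Counting.
Variables (gT : finGroupType) (G : {group gT}).

Definition cyclic_subgroups := [set H : {group gT} | (H \subset G) && cyclic H].
Definition large_cyclic := [set H in cyclic_subgroups | 2 < #|H|].
Definition large_elements := [set x in G | 2 < #[x]].

(** Each x generates exactly one cyclic subgroup, and a cyclic [H] has [totient #|H|] generators. *)
Lemma sum_totient_cyclic (P : pred nat) :
  \sum_(H in cyclic_subgroups | P #|H|) totient #|H| = #|[set x in G | P #[x]]|.
Proof.
rewrite -sum1_card (partition_big (fun x => <[x]>%G)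
   (fun H => (H \in cyclic_subgroups) && P #|H|)) /=; last first.
  by move=> x; rewrite !inE cycle_subG cycle_cyclic => /andP[-> ->].
apply: eq_bigr => H; rewrite inE -andbA => /and3P[sHG /cyclicP[a /val_inj defH] PH].
rewrite {H}defH in sHG PH *; rewrite totient_gen -sum1_card; apply: eq_bigl => x.
rewrite !inE /generator; apply/eqP/andP=> [xa | [_ /eqP xa]]; last first.
  exact: (esym (congr1 (@gval gT) xa)).
by rewrite -cycle_subG /order -xa sHG PH; split=> //; apply/eqP/val_inj.
Qed.

Lemma sum_totient_large : \sum_(H in large_cyclic) totient #|H| = #|large_elements|.
Proof. by rewrite -(sum_totient_cyclic (ltn 2)); apply: eq_bigl => H; rewrite inE. Qed.

Lemma card_cyclic_subgroups :
  #|cyclic_subgroups| + #|large_elements| = #|G| + #|large_cyclic|.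
Proof.
have cG: \sum_(H in cyclic_subgroups) totient #|H| = #|G|.
  rewrite -[RHS](eq_card (A := [set x in G | predT #[x]])); last first.
    by move=> x; rewrite !inE andbT.
  by rewrite -(sum_totient_cyclic predT); apply: eq_bigl => H; rewrite andbT.
have sLC: cyclic_subgroups :&: large_cyclic = large_cyclic.
  by apply/setIidPr/subsetP=> H; rewrite inE => /andP[].
rewrite -cG (big_setID large_cyclic) /= -(cardsID large_cyclic cyclic_subgroups).
rewrite sLC -sum_totient_large.
set D := cyclic_subgroups :\: large_cyclic.
(* Cyclic subgroups of order 1 or 2 have a single generator, so they count equally on both sides. *)
suff ->: \sum_(H in D) totient #|H| = #|D|.
  by rewrite [LHS]addnAC [RHS]addnAC; congr (_ + _); apply: addnC.
rewrite -sum1_card; apply: eq_bigr => H; rewrite !inE => /andP[nlarge /andP[sHG cH]].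
move: nlarge; rewrite sHG cH -totient_gt1 -leqNgt /= => le1.
by apply/eqP; rewrite eqn_leq le1 totient_gt0 cardG_gt0.
Qed.

Lemma cyclic_deficit : #|cyclic_subgroups| = (#|G| - 3)%N ->
  #|large_elements| = (#|large_cyclic| + 3)%N.
Proof.
(* The trivial subgroup makes the count positive, so [#|G| - 3] is not truncated. *)
move=> cG; have c_gt0: 0 < #|cyclic_subgroups|.
  by apply/card_gt0P; exists 1%G; rewrite inE sub1G cyclic1.
have := card_cyclic_subgroups; rewrite cG.
have G_gt3: 3 < #|G| by rewrite -subn_gt0 -cG.
rewrite -{2}(subnK (ltnW G_gt3)) -addnA => /addnI->; exact: addnC.
Qed.

Lemma large_cycle x : x \in large_elements -> <[x]>%G \in large_cyclic.
Proof. by rewrite !inE cycle_subG cycle_cyclic andbT. Qed.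

Lemma cyclic_dichotomy : #|cyclic_subgroups| = (#|G| - 3)%N ->
     (exists2 H : {group gT}, #|H| = 5%N & H \subset G /\ large_elements \subset H)
  \/ [/\ #|large_cyclic| = 3%N, #|large_elements| = 6%N
       & {in large_cyclic, forall H : {group gT}, #|H| \in [:: 3; 4; 6]%N}].
Proof.
move/cyclic_deficit=> cS.
have sum3: \sum_(H in large_cyclic) (totient #|H| - 1) = 3.
  apply/eqP; rewrite -(eqn_add2l #|large_cyclic|) -cS -sum_totient_large.
  rewrite -sum1_card -big_split /=; apply/eqP/eq_bigr => H _.
  by rewrite subnKC // totient_gt0 cardG_gt0.
have oB: {in large_cyclic,
    forall H : {group gT}, #|H| \in [:: 3; 4; 6; 5; 8; 10; 12]%N}.
  move=> H BH; have: totient #|H| <= 4.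
    by rewrite -[4]/(1 + 3)%N -leq_subLR -sum3 (bigD1 H) //= leq_addr.
  move/(totient_le4 (cardG_gt0 H)); move: BH; rewrite !inE => /andP[_].
  move: #|H| => m m_gt2; do 8?[case/orP=> [/eqP em|]; first by rewrite em in m_gt2 *].
  by move/eqP->.
(* The orders 5, 8, 10, 12 have totient 4 and contribute 3 to the sum; the orders 3, 4, 6 have
   totient 2 and contribute 1. *)
have [/exists_inP[H BH oH] | /exists_inPn noB] :=
    boolP [exists H in large_cyclic, #|H| \in [:: 5; 8; 10; 12]%N].
  have onlyH K : K \in large_cyclic -> K = H.
    move=> BK; apply/eqP; apply: contraT => neKH.
    move: sum3; rewrite (bigD1 H) //= (bigD1 K) ?BK //=.
    have ->: (totient #|H| - 1 = 3)%N.
      by move: oH; rewrite !inE; do ![case/orP=> [/eqP->|] //]; move/eqP->.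
    move/eqP; rewrite -[X in _ == X]addn0 eqn_add2l addn_eq0 subn_eq0 leqNgt totient_gt1.
    by move: BK; rewrite inE => /andP[_ ->].
  left; exists H.
    (* A divisor d > 2 of the order of [H] yields a large cyclic subgroup inside [H], hence [H]
       itself. The divisors 4, 5, 3 thus rule out the orders 8, 10, 12. *)
    have onlyd d : d %| #|H| -> 2 < d -> d = #|H|.
      move=> d_H d_gt2; move: (BH); rewrite !inE => /andP[/andP[sHG /cyclicP[a defH]] _].
      have Ha: a \in H by rewrite defH cycle_id.
      pose y := a ^+ (#|H| %/ d).
      have oy: #[y] = d.
        have oa: #[a] = #|H| by rewrite defH.
        by rewrite orderXdiv oa ?dvdn_div // divnA // mulKn.
      rewrite -{1}oy -(onlyH <[y]>%G) // large_cycle // inE oy d_gt2 andbT.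
      by rewrite (subsetP sHG) // groupX.
    move: oH onlyd; rewrite !inE.
    case/orP=> [/eqP-> // | /or3P[] /eqP-> onlyd].
    - by have := onlyd 4%N isT isT.
    - by have := onlyd 5%N isT isT.
    - by have := onlyd 3%N isT isT.
  move: (BH); rewrite !inE => /andP[/andP[sHG _] _]; split=> //.
  by apply/subsetP=> x /large_cycle/onlyH <-; apply: cycle_id.
right.
have oB' : {in large_cyclic, forall H : {group gT}, #|H| \in [:: 3; 4; 6]%N}.
  move=> H BH; have := oB H BH; have := noB H BH; rewrite !inE.
  by case: (_ == 3%N); case: (_ == 4%N); case: (_ == 6%N) => //= /negPf->.
have cB: #|large_cyclic| = 3%N.
  rewrite -[RHS]sum3 -sum1_card; apply: eq_bigr => H /oB'.
  by rewrite !inE; do ![case/orP=> [/eqP->|] //]; move/eqP->.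
by rewrite cS cB.
Qed.
End Counting.

(** * Inversion by conjugation, and the case of one subgroup of order 5 *)

Lemma order_gt2 (gT : finGroupType) (x : gT) : (2 < #[x]) = (x ^+ 2 != 1).
Proof.
rewrite ltnNge -order_dvdn; congr (~~ _); apply/idP/idP=> [|/dvdn_leq->//].
by have := order_gt0 x; case: #[x] => [|[|[|n]]].
Qed.

(** The only generators of [<[a]>] are a and its inverse, and conjugation by x permutes them. *)
Lemma conj_generator_totient2 (gT : finGroupType) (a x : gT) :
  totient #[a] = 2 -> x \in 'N(<[a]>) -> a ^ x = a \/ a ^ x = a^-1.
Proof.
move=> oa Nx; have a2: a != a^-1.
  by rewrite eq_sym eq_invg_mul -(expgS _ 1) -order_gt2 -totient_gt1 oa.
have gen2: [set a; a^-1] = [set z | generator <[a]> z].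
  apply/eqP; rewrite eqEcard -totient_gen oa cards2 a2 subUset !sub1set !inE.
  by rewrite generator_cycle /generator cycleV eqxx.
have: a ^ x \in [set a; a^-1] by rewrite gen2 inE /generator cycleJ (normP Nx).
by rewrite !inE => /orP[]/eqP; [left | right].
Qed.

(** Both y and y h lie outside [H], so their squares are 1; expanding y h y h = 1 with y = y^-1
    gives the claim. *)
Lemma invert_outside (gT : finGroupType) (G H : {group gT}) (y h : gT) :
  H \subset G -> large_elements G \subset H ->
  y \in G :\: H -> h \in H -> h ^ y = h^-1.
Proof.
move=> sHG sSH /setDP[Gy H'y] Hh.
have sqr1 z : z \in G -> z \notin H -> z ^+ 2 = 1.
  move=> Gz; apply: contraNeq; rewrite -order_gt2 => z2.
  by rewrite (subsetP sSH) // inE Gz.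
have yV: y^-1 = y by apply/eqP; rewrite eq_invg_mul -(expgS _ 1) sqr1.
have: (y * h) ^+ 2 = 1.
  by apply: sqr1; [rewrite groupM // (subsetP sHG) | rewrite groupMr].
rewrite expgS expg1 /conjg yV !mulgA => yhyh.
by apply: (mulIg h); rewrite mulVg.
Qed.

Lemma isog_large_order5 (gT : finGroupType) (G H : {group gT}) :
    #|H| = 5 -> H \subset G -> large_elements G \subset H ->
  G \isog [set: 'Z_5] \/ G \isog 'D_10.
Proof.
move=> oH sHG sSH; have prH: prime #|H| by rewrite oH.
have [a defH] := cyclicP (prime_cyclic prH).
have oa: #[a] = 5 by rewrite -oH defH.
have Ha: a \in H by rewrite defH cycle_id.
have a2: a^-1 != a by rewrite eq_invg_mul -(expgS _ 1) -order_gt2 oa.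
have [sGH | /subsetPn[y Gy H'y]] := boolP (G \subset H).
  have {sGH} defG: G = H by apply/val_inj/eqP; rewrite eqEsubset sGH.
  left; have oZ: #|[set: 'Z_5]| = 5 by rewrite cardsT card_ord.
  by rewrite defG isog_cyclic_card ?prime_cyclic ?oZ ?oH.
right; have inv z h := @invert_outside _ _ _ z h sHG sSH.
have y2: y ^+ 2 = 1.
  apply: contraNeq H'y; rewrite -order_gt2 => y2.
  by rewrite (subsetP sSH) // inE Gy.
have homG: G \homg 'D_(5.*2).
  rewrite Grp_dihedral //; apply/existsP; exists (a, y).
  rewrite /= !xpair_eqE -{1}oa expg_order y2 inv ?inE ?H'y // !eqxx !andbT.
  rewrite eqEsubset join_subG !cycle_subG (subsetP sHG) //= Gy /=.
  (* [H] has index at most 2: if z, y and z y were all outside [H], then z y would invert a, while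
     two successive inversions fix it. *)
  apply/subsetP=> z Gz; rewrite -defH.
  have [Hz | H'z] := boolP (z \in H); first by rewrite mem_gen // inE Hz.
  have [Hzy | H'zy] := boolP (z * y \in H).
    rewrite -[z](mulgK y) groupM ?groupV //; first by rewrite mem_gen // inE Hzy.
    by rewrite mem_gen // inE cycle_id orbT.
  case/eqP: a2; rewrite -(inv (z * y)) ?inE ?H'zy ?groupM //.
  by rewrite conjgM !inv ?inE ?H'y ?H'z ?groupV // invgK.
rewrite isogEcard homG (card_dihedral (isT : 1 < 5)) /=.
(* The order of G is a multiple of 5 above 5, so it is at least 10 and the surjection from ['D_10]
   is an isomorphism. *)
have : H \proper G by rewrite properE sHG; apply/subsetPn; exists y.
move/proper_card; rewrite oH => G_gt5.
have [k oG] : exists k, #|G| = (k * 5)%N by apply/dvdnP; rewrite -oH cardSg.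
by move: G_gt5; rewrite oG; case: k {oG} => [|[|k]] // _; rewrite !mulSn.
Qed.

(** * The case of three cyclic subgroups of order 3, 4 or 6 *)

Section ThreeLargeCyclic.

Variables (gT : finGroupType) (G : {group gT}).
Hypothesis card_B : #|large_cyclic G| = 3%N.
Hypothesis card_S : #|large_elements G| = 6%N.
Hypothesis order_B :
  {in large_cyclic G, forall H : {group gT}, #|H| \in [:: 3; 4; 6]%N}.

Lemma order_large x : x \in large_elements G -> #[x] \in [:: 3; 4; 6]%N.
Proof. by move/large_cycle/order_B. Qed.

Lemma totient_large x : x \in large_elements G -> totient #[x] = 2.
Proof. by move/order_large; rewrite !inE => /or3P[] /eqP->. Qed.

Lemma acts_large_cyclic : [acts G, on large_cyclic G | 'JG].
Proof.
apply/actsP=> x Gx H /=.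
by rewrite !inE /= cardJg cyclicJ -{1}(conjGid Gx) conjSg.
Qed.

Lemma no_order3 c : c \in G -> #[c] != 3.
Proof.
move=> Gc; apply/eqP=> oc; pose P := <[c]>%G.
have Sc: c \in large_elements G by rewrite inE Gc oc.
have sPG: P \subset G by rewrite cycle_subG.
have pP: 3.-group P by rewrite /pgroup -orderE oc.
have actP: [acts P, on large_cyclic G | 'JG] := subset_trans sPG acts_large_cyclic.
(* The number of fixed points is divisible by 3, and positive since [P] fixes itself, so all three
   subgroups are fixed. *)
have fixP : 'Fix_(large_cyclic G | 'JG)(P) = large_cyclic G.
  apply/eqP; rewrite eqEcard subsetIl /= card_B.
  have : #|'Fix_(large_cyclic G | 'JG)(P)| %% 3 = 0.
    by rewrite -(pgroup_fix_mod pP actP) card_B.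
  have : 0 < #|'Fix_(large_cyclic G | 'JG)(P)|.
    by apply/card_gt0P; exists P; rewrite inE large_cycle // afixJG normG.
  by case: #|_| => [|[|[|n]]].
have centS x : x \in large_elements G -> x \in 'C_G[c].
  move=> Sx; have Gx : x \in G by move: Sx; rewrite inE => /andP[].
  have: <[x]>%G \in 'Fix_(large_cyclic G | 'JG)(P) by rewrite fixP large_cycle.
  rewrite inE afixJG cycle_subG => /andP[_ Nc].
  rewrite inE Gx; apply/cent1P/commgP/conjg_fixP.
  (* If c inverted x, so would c^3 = 1, giving x^2 = 1. *)
  have [// | xcV] := conj_generator_totient2 (totient_large Sx) Nc.
  have : x ^ (c ^+ 3) = x^-1.
    by rewrite !expgS expg0 mulg1 !conjgM xcV conjVg xcV invgK xcV.
  rewrite -oc expg_order conjg1 => xV; move: Sx; rewrite inE Gx order_gt2 expgS.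
  by rewrite {2}xV mulgV eqxx.
(* [I] is the set of solutions of x^2 = 1 in the centralizer [K], which contains all six large
   elements. *)
pose K := 'C_G[c]%G; pose I := K :\: large_elements G.
have sqI x : x \in I -> x ^+ 2 = 1.
  case/setDP=> /setIP[Gx _]; rewrite inE Gx /= order_gt2 negbK; exact/eqP.
have oK: #|K| = (6 + #|I|)%N.
  by rewrite -card_S -(cardsID (large_elements G) K) (setIidPr _) //; apply/subsetP.
have Ix_comm x : x \in I -> commute c x.
  by case/setDP=> /setIP[_ /cent1P cx] _.
have c2 : c ^+ 2 != 1 by rewrite -order_gt2 oc.
have sIK x : x \in I -> x \in G by case/setDP=> /setIP[].
have sq_transl x : x \in I -> (c * x) ^+ 2 = c ^+ 2 /\ (c^-1 * x) ^+ 2 = (c ^+ 2)^-1.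
  move=> Ix; have cx := Ix_comm x Ix; have x2 := sqI x Ix.
  split; rewrite expgMn ?x2 ?mulg1 ?expgVn //.
  exact/commute_sym/commuteV/commute_sym.
have sIS : c *: I :|: c^-1 *: I \subset large_elements G.
  apply/subsetP=> y /setUP[] /lcosetP[x Ix ->]; have [cx cVx] := sq_transl x Ix.
    by rewrite inE order_gt2 cx c2 andbT groupM // sIK.
  by rewrite inE order_gt2 cVx invg_eq1 c2 andbT groupM ?groupV // sIK.
(* A common element would give c^2 = c^-2. *)
have disj : [disjoint c *: I & c^-1 *: I].
  rewrite -setI_eq0; apply/eqP/setP=> y; rewrite !inE; apply/andP=> -[].
  case/lcosetP=> x Ix ->{y} /lcosetP[y Iy /(congr1 (fun z => z ^+ 2))].
  have [-> _] := sq_transl x Ix; have [_ ->] := sq_transl y Iy.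
  move/eqP; rewrite eq_sym eq_invg_mul -expgD -order_dvdn oc => c4.
  by have := c4.
have I3: #|I| <= 3.
  rewrite -leq_double -addnn -{1}(card_lcoset I c) -{1}(card_lcoset I c^-1).
  move: (subset_leq_card sIS); rewrite cardsU card_S.
  by move: disj; rewrite -setI_eq0 => /eqP->; rewrite cards0 subn0.
have I1: 1 \in I by rewrite inE group1 inE order1 andbF.
have dv3: 3 %| #|K| by rewrite -oc order_dvdG // inE Gc cent1id.
(* As 3 divides 6 + |I| with |I| between 1 and 3, [K] has order 9; but a nontrivial element of [I]
   has order 2. *)
have oI: #|I| = 3.
  have : 0 < #|I| by apply/card_gt0P; exists 1.
  by move: dv3; rewrite oK; move: I3; case: #|I| => [|[|[|[]]]].
have [x Ix x1] : exists2 x, x \in I & x != 1.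
  have: 0 < #|I :\ 1| by have := oI; rewrite (cardsD1 1) I1 add1n => -[->].
  by case/card_gt0P=> x /setD1P[]; exists x.
have: #[x] %| #|K| by apply: order_dvdG; case/setDP: Ix.
suff ->: #[x] = 2 by rewrite oK oI.
by apply: nt_prime_order => //; apply: sqI.
Qed.

Lemma order_large4 x : x \in large_elements G -> #[x] = 4.
Proof.
move=> Sx; have Gx : x \in G by move: Sx; rewrite inE => /andP[].
have := order_large Sx; rewrite !inE => /or3P[] /eqP ox //.
  by have := no_order3 Gx; rewrite ox.
by have := no_order3 (groupX 2 Gx); rewrite orderXdiv ox.
Qed.

(** An element of odd prime order would be large, hence of order 4. *)
Lemma pgroup2 : 2.-group G.
Proof.
apply/pnatP=> // p p_pr /(Cauchy p_pr)[x Gx ox]; apply: contraLR isT => p2.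
have: x \in large_elements G.
  by rewrite inE Gx ox ltn_neqAle prime_gt1 // andbT eq_sym.
by move/order_large4; rewrite ox => p4; rewrite p4 in p_pr.
Qed.

(** The 2-group G acts on three subgroups with an odd number of fixed points, so at least one is
    normal. *)
Lemma normal_cycle4 : exists2 a, a \in large_elements G & G \subset 'N(<[a]>).
Proof.
have: #|'Fix_(large_cyclic G | 'JG)(G)| %% 2 = 1%N.
  by rewrite -(pgroup_fix_mod pgroup2 acts_large_cyclic) card_B.
have [-> | [A]] := set_0Vmem ('Fix_(large_cyclic G | 'JG)(G)); first by rewrite cards0.
rewrite inE afixJG => /andP[BA nA] _; move: BA nA; rewrite !inE.
case/andP=> /andP[sAG /cyclicP[a defA]] A_gt2; rewrite {1}defA => nA; exists a => //.
by rewrite inE (subsetP sAG) ?defA ?cycle_id // orderE -defA.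
Qed.

(** Otherwise the centralizer of a has order 8 and a^2 is its only involution. A large x outside
    [<[a]>] then satisfies x^2 = a^2, so x a^-1 has square 1 and x falls back into [<[a]>]. *)
Lemma large_not_cent a : a \in large_elements G ->
  exists2 x, x \in large_elements G & x \notin 'C[a].
Proof.
move=> Sa; have Ga : a \in G by move: Sa; rewrite inE => /andP[].
have oa := order_large4 Sa.
apply/subsetPn/negP=> cS; pose K := 'C_G[a]%G; pose I := K :\: large_elements G.
have sqI x : (x \in I) = (x \in K) && (x ^+ 2 == 1).
  rewrite /I in_setD [x \in large_elements G]inE order_gt2 andbC.
  by case Kx: (x \in K) => //; case/setIP: Kx => -> _; rewrite negbK.
have oK : #|K| = (6 + #|I|)%N.
  rewrite -card_S -(cardsID (large_elements G) K) (setIidPr _) //; apply/subsetP=> x Sx.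
  by rewrite inE (subsetP cS) // andbT; move: Sx; rewrite inE => /andP[].
have cK x : x \in K -> commute x a by case/setIP=> _ /cent1P/commute_sym.
have I6 : #|I| <= 6.
  rewrite -card_S -(card_lcoset I a); apply/subset_leq_card/subsetP=> y.
  case/lcosetP=> x; rewrite sqI => /andP[Kx /eqP x2] ->; rewrite inE order_gt2.
  rewrite expgMn ?x2 ?mulg1 -?order_gt2 ?oa ?andbT; last exact/commute_sym/cK.
  by rewrite groupM //; case/setIP: Kx.
have a2 : a ^+ 2 != 1 by rewrite -order_gt2 oa.
have a4 : a ^+ 4 = 1 by rewrite -oa expg_order.
have Ka : a \in K by rewrite inE Ga cent1id.
have I1 : 1 \in I by rewrite sqI group1 expg1n eqxx.
have Ia2 : a ^+ 2 \in I by rewrite sqI groupX //= -expgM a4.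
have s2I : [set 1; a ^+ 2] \subset I by rewrite subUset !sub1set I1.
have I2 : 2 <= #|I| by have := subset_leq_card s2I; rewrite cards2 eq_sym a2.
have oI : #|I| = 2.
  have : 2.-group K := pgroupS (subsetIl _ _) pgroup2.
  case/p_natP=> // k; rewrite oK => oKk.
  (* The power of 2 equal to 6 + |I| lies between 8 and 12, so it is 8. *)
  have : 2 ^ k < 2 ^ 4.
    by rewrite -oKk -[X in _ < X]/(6 + 10)%N ltn_add2l (leq_ltn_trans I6).
  rewrite ltn_exp2l // ltnS -(@leq_exp2l 2) // -oKk -[X in _ <= X]/(6 + 2)%N leq_add2l.
  by move=> le2; apply/eqP; rewrite eqn_leq le2.
have defI : I = [set 1; a ^+ 2].
  by apply/esym/eqP; rewrite eqEcard s2I oI cards2 eq_sym a2.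
have [x Sx ax] : exists2 x, x \in large_elements G & x \notin <[a]>.
  apply/subsetPn/negP=> /subset_leq_card; by rewrite card_S -orderE oa.
have ox := order_large4 Sx.
have Kx : x \in K by rewrite inE (subsetP cS) // andbT; move: Sx; rewrite inE => /andP[].
have x2 : x ^+ 2 = a ^+ 2.
  have x4 : x ^+ 4 = 1 by rewrite -ox expg_order.
  have : x ^+ 2 \in I by rewrite sqI groupX //= -expgM x4.
  rewrite defI !inE => /orP[]/eqP // x2.
  by have := order_gt2 x; rewrite x2 ox eqxx.
have : x * a^-1 \in I.
  rewrite sqI groupM ?groupV //= expgMn; last exact/commuteV/cK.
  by rewrite x2 expgVn mulgV.
rewrite defI => xa; case/negP: ax; rewrite -[x](mulgKV a) groupM ?cycle_id //.
by move: xa; rewrite !inE => /orP[]/eqP->; rewrite ?group1 ?mem_cycle.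
Qed.

Lemma isog_three_large_cyclic : G \isog 'Q_8.
Proof.
have [a Sa nA] := normal_cycle4; have [x Sx cx] := large_not_cent Sa.
have mem_S y : y \in large_elements G -> y \in G by rewrite inE => /andP[].
have [Ga Gx] := (mem_S _ Sa, mem_S _ Sx).
have [oa ox] := (order_large4 Sa, order_large4 Sx).
have a2 : a ^+ 2 != 1 by rewrite -order_gt2 oa.
have axV : a ^ x = a^-1.
  have [/conjg_fixP/commgP/cent1P|//] :=
    conj_generator_totient2 (totient_large Sa) (subsetP nA x Gx).
  by rewrite cent1C (negPf cx).
have Ca : <[a]> \subset 'C[a] by rewrite cycle_subG cent1id.
have sq_coset y : y \in <[a]> -> (x * y) ^+ 2 = x ^+ 2.
  case/cycleP=> i ->; rewrite expgS expg1 -mulgA [a ^+ i * _]mulgA [a ^+ i * x]conjgC.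
  by rewrite conjXg axV expgVn mulgKV expgS.
(* The left side consists of 2 + 4 large elements, so it exhausts the six. *)
have defS : [set a; a^-1] :|: x *: <[a]> = large_elements G.
  apply/eqP; rewrite eqEcard; apply/andP; split.
    rewrite !subUset !sub1set Sa !inE orderV oa groupV Ga /=.
    apply/subsetP=> z /lcosetP[y Ay ->]; rewrite inE order_gt2 sq_coset // -order_gt2 ox.
    by rewrite groupM // (subsetP _ _ Ay) // cycle_subG.
  rewrite card_S cardsU card_lcoset -orderE oa cards2 eq_sym eq_invg_mul -(expgS _ 1) a2.
  rewrite (_ : _ :&: _ = set0) ?cards0 //; apply/setP=> z; rewrite !inE.
  apply/negP=> /andP[z1 /lcosetP[y Ay zE]]; case/negP: cx; apply: (subsetP Ca).
  have Az : z \in <[a]> by case/orP: z1 => /eqP->; rewrite ?groupV cycle_id.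
  by rewrite -(mulgK y x) -zE groupM ?groupV.
have [a4 x4] : a ^+ 4 = 1 /\ x ^+ 4 = 1 by rewrite -{1}oa -ox !expg_order.
(* Otherwise a x^2, whose square is a^2, is large, so [defS] leaves three cases: it is a and x^2 =
   1, or a^-1 and x^2 = a^2, or x y with y in [<[a]>] and x centralizes a. Each is impossible. *)
have x2 : x ^+ 2 = a ^+ 2.
  apply/eqP; apply: contraT => nx2.
  have x2a : commute a (x ^+ 2).
    by apply/commgP/conjg_fixP; rewrite expgS expg1 conjgM axV conjVg axV invgK.
  have : a * x ^+ 2 \in large_elements G.
    by rewrite inE order_gt2 groupM ?groupX // expgMn // -expgM x4 mulg1.
  rewrite -defS !inE -orbA => /or3P[/eqP e|/eqP e|/lcosetP[y Ay e]].
  - by have := order_gt2 x; rewrite ox (mulgI a _ 1 (etrans e (esym (mulg1 a)))) eqxx.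
  - case/eqP: nx2; apply: (mulgI a); rewrite e -expgS; apply/eqP.
    by rewrite eq_invg_mul -expgS a4.
  - have cx2 : x ^+ 2 \in 'C[a] by apply/cent1P/commute_sym.
    case/negP: cx; rewrite -(mulgK y x) -e.
    by apply: groupM; [apply: groupM; rewrite ?cent1id | rewrite groupV (subsetP Ca)].
pose Q := <[a]> <*> <[x]>.
have Qa : a \in Q by rewrite mem_gen // inE cycle_id.
have Qx : x \in Q by rewrite mem_gen // inE cycle_id orbT.
have sQG : Q \subset G by rewrite join_subG !cycle_subG Ga.
have sSQ : large_elements G \subset Q.
  rewrite -defS !subUset !sub1set groupV Qa /=; apply/subsetP=> z /lcosetP[y Ay ->].
  by rewrite groupM // mem_gen // inE Ay.
have defG : Q = G.
  apply/eqP; rewrite eqEsubset sQG; apply/subsetP=> y Gy; apply: contraR cx => Qy.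
  (* An outside y would invert all of [Q]; inverting the product a x then forces a and x to
     commute. *)
  have inv z : z \in Q -> z ^ y = z^-1.
    by move=> Qz; apply: (invert_outside sQG sSQ); rewrite // inE Qy.
  have := inv _ (groupM Qa Qx); rewrite conjMg !inv // -invMg => /invg_inj e.
  exact/cent1P.
have homG : G \homg 'Q_(2 ^ 3).
  rewrite Grp_quaternion //; apply/existsP; exists (a, x).
  by rewrite /= !xpair_eqE -/Q defG axV x2 a4 !eqxx.
rewrite isogEcard homG (card_quaternion (isT : 2 < 3)) /=.
(* The order of G divides 8 and exceeds 6, since 1 is not large. *)
have : #|large_elements G| < #|G|.
  apply/proper_card; rewrite properE; apply/andP; split; first by rewrite -defG.
  by apply/subsetPn; exists 1 => //; rewrite inE order1 andbF.
rewrite card_S; have := card_homg homG; rewrite card_quaternion // => dv.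
by case: #|G| dv => [|[|[|[|[|[|[|[|n]]]]]]]].
Qed.

End ThreeLargeCyclic.

(** * The converse: counting in C_5, D_10 and Q_8 *)

Lemma card_cyclic_equiorder (gT : finGroupType) (G : {group gT}) k m :
    0 < k -> (forall x, x \in large_elements G -> #[x] = k) ->
    #|large_elements G| = (m * totient k)%N ->
  (#|cyclic_subgroups G| + m * totient k = #|G| + m)%N.
Proof.
move=> k_gt0 oS cS; rewrite -cS card_cyclic_subgroups; congr (_ + _).
(* Every large cyclic subgroup has [totient k] generators, so there are m of them. *)
apply/eqP; rewrite -(@eqn_pmul2r (totient k)) ?totient_gt0 // -cS -sum_totient_large.
rewrite -sum_nat_const; apply/eqP/eq_bigr => H.
rewrite !inE => /andP[/andP[sHG /cyclicP[a defH]] H_gt2].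
have oH : #[a] = #|H| by rewrite orderE -defH.
by rewrite -oH oS // inE oH H_gt2 (subsetP sHG) // defH cycle_id.
Qed.

(** The large elements are the four nontrivial elements of [H]: one subgroup, with [k] = 5. *)
Lemma cyclic_count_order5 (gT : finGroupType) (G H : {group gT}) :
    #|H| = 5 -> H \subset G -> large_elements G \subset H ->
  #|cyclic_subgroups G| = (#|G| - 3)%N.
Proof.
move=> oH sHG sSH; have oS x : x \in H^# -> #[x] = 5.
  by case/setD1P=> x1 Hx; apply: nt_prime_order => //; rewrite -oH expg_cardG.
have defS : large_elements G = H^#.
  apply/eqP; rewrite eqEsubset subsetD1 sSH !inE order1 andbF /=.
  apply/subsetP=> x H1x; rewrite inE oS // andbT (subsetP sHG) //.
  by case/setD1P: H1x.
have c4 : #|H^#| = 4 by have := oH; rewrite (cardsD1 1) group1 add1n => -[].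
have := @card_cyclic_equiorder _ G 5 1 isT; rewrite defS => /(_ oS c4) E.
by rewrite -[RHS](subnDr 1) -E addnK.
Qed.

Lemma cyclic_count_quaternion (gT : finGroupType) (G : {group gT}) :
  G \isog 'Q_8 -> #|cyclic_subgroups G| = (#|G| - 3)%N.
Proof.
move=> isoQ; have [[x y] genG _] := @generators_quaternion _ G 3 isT isoQ.
have [[_ o4 _] _ _ _ _] := quaternion_structure (isT : 2 < 3) genG isoQ.
have {genG} [oG Gx ox _] := genG; rewrite /= in oG ox.
have x2 : x ^+ 2 != 1 by rewrite -order_gt2 ox.
have oS z : z \in large_elements G -> #[z] = 4.
  rewrite inE => /andP[Gz z_gt2].
  have [xz | x'z] := boolP (z \in <[x]>); last by rewrite o4 // inE x'z.
  have := order_dvdG xz; rewrite -orderE ox => dv; have := dvdn_leq (isT : 0 < 4) dv.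
  by case: #[z] z_gt2 dv => [|[|[|[|[|]]]]].
(* Outside [<[x]>] all orders are 4; inside it only 1 and x^2 have square 1. This leaves six
   elements, in three subgroups of order 4. *)
have defS : large_elements G = G :\: [set 1; x ^+ 2].
  apply/setP=> z; rewrite !inE order_gt2 negb_or andbC.
  case Gz: (z \in G); rewrite ?andbF ?andbT //.
  have [xz | x'z] := boolP (z \in <[x]>).
    have [i lt_i ->] := cyclePmin xz; rewrite ox in lt_i.
    rewrite -expgM -(expg0 x) !eq_expg_mod_order ox.
    by case: i lt_i => [|[|[|[|]]]].
  rewrite -order_gt2 o4 ?inE ?x'z //; symmetry.
  by apply/andP; split; apply: contraNneq x'z => ->; rewrite ?group1 ?mem_cycle.
have cS : #|large_elements G| = 6.
  rewrite defS cardsD (setIidPr _) ?cards2 1?eq_sym ?x2 ?oG //.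
  by rewrite subUset !sub1set group1 groupX.
have := @card_cyclic_equiorder _ G 4 3 isT oS cS; rewrite oG /= => E.
by apply/eqP; rewrite -(eqn_add2r 6); apply/eqP.
Qed.

Lemma dihedral10_large_order5 (gT : finGroupType) (G : {group gT}) : G \isog 'D_10 ->
  exists2 H : {group gT}, #|H| = 5%N & H \subset G /\ large_elements G \subset H.
Proof.
case/(isoGrpP _ (Grp_dihedral (isT : 1 < 5))).
rewrite (card_dihedral (isT : 1 < 5)) => oG /existsP[[x y] /= /eqP[defG x5 y2 xy]].
have nXy : <[y]> \subset 'N(<[x]>) by rewrite norms_cycle xy groupV cycle_id.
rewrite norm_joinEr // in defG.
have [Gx Gy] : x \in G /\ y \in G by apply/andP; rewrite -!cycle_subG -mulG_subG defG.
(* The relations alone allow x = 1, but then G = [<[y]>] would have order at most 2 instead of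
   10. *)
have x1 : x != 1.
  apply/eqP=> x1; have := oG; rewrite -defG x1 /= cycle1 mul1g -orderE => oy.
  by have := order_dvdn y 2; rewrite y2 eqxx oy.
exists <[x]>%G.
  by rewrite -orderE; apply: nt_prime_order.
split; first by rewrite cycle_subG.
apply/subsetP=> z; rewrite inE order_gt2 -{1}defG => /andP[/mulsgP[u v Xu]].
(* Only the parity of j matters: for even j the element is in [<[x]>], and for odd j it is u y, of
   square 1 because y inverts u. *)
case/cycleP=> j -> ->; rewrite -(odd_double_half j) expgD -mul2n expgM y2 expg1n mulg1.
case: (odd j); last by rewrite expg0 mulg1.
case/negP; apply/eqP; rewrite expg1; case/cycleP: Xu => i ->.
have yV: y^-1 = y by apply/eqP; rewrite eq_invg_mul -(expgS _ 1) y2.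
rewrite expgS expg1 -mulgA -{1}yV -[y^-1 * _]/(x ^+ i ^ y) conjXg xy expgVn.
exact: mulgV.
Qed.

Unset Implicit Arguments.

Theorem theorem3 (gT : finGroupType) (G : {group gT}) :
  #|[set H : {group gT} | (H \subset G) && cyclic H]| = (#|G| - 3)%N <->
  [\/ G \isog 'Q_8, G \isog [set: 'Z_5] | G \isog 'D_10].
Proof.
rewrite -/(cyclic_subgroups G); split=> [cG | [isoQ | isoZ | isoD]].
- have [[H oH [sHG sSH]] | [cB cS oB]] := cyclic_dichotomy cG.
    by have [] := isog_large_order5 oH sHG sSH; [constructor 2 | constructor 3].
  by constructor 1; apply: isog_three_large_cyclic.
- exact: cyclic_count_quaternion.
- apply: (@cyclic_count_order5 _ G G); rewrite ?(card_isog isoZ) ?cardsT ?card_ord //.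
  by apply/subsetP=> x; rewrite inE => /andP[].
have [H oH [sHG sSH]] := dihedral10_large_order5 isoD.
exact: cyclic_count_order5 oH sHG sSH.
Qed.
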